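(* Let $d\ge 2$ and let $(a,x,y,b)$ be a positive quadruple of flags in $\mathcal F_d$. Then any $d$ lines in $$\{L_1(a,b),\ldots,L_d(a,b),L_1(x,y),\ldots,L_d(x,y)\}$$ are in general position; that is, for all $I,J\subset\{1,\dots,d\}$ with $|I|+|J|=d$, the lines $L_i(a,b)$ ($i\in I$) and $L_j(x,y)$ ($j\in J$) together span $\mathbb R^d$.
   Context: A flag in $\mathbb R^d$ is a nested family $f=(f^1\subset\cdots\subset f^{d-1})$ of subspaces with $\dim f^i=i$ (and $f^0=0$, $f^d=\mathbb R^d$); $\mathcal F_d$ is the space of flags. An $n$-tuple $(f_1,\dots,f_n)$ of flags is transverse if $f_1^{d_1}\oplus\cdots\oplus f_n^{d_n}=\mathbb R^d$ for all non-negative integers $d_1,\dots,d_n$ with sum $d$; $\mathcal F_d^{(n)}$ is the set of transverse $n$-tuples. If $(a,b)\in\mathcal F_d^{(2)}$, let $L_i(a,b)=a^i\cap b^{d-i+1}$, $i=1,\dots,d$; these are lines with $\mathbb R^d=\bigoplus_iL_i(a,b)$. A basis $\varepsilon=(e_i)$ of $\mathbb R^d$ is consistent with $(a,b)$ if $e_i\in L_i(a,b)$ for all $i$. For a basis $\varepsilon$ consistent with $(a,b)$, let $U(\varepsilon)_{\ge0}$ be the set of linear maps whose matrix with respect to $\varepsilon$ is unipotent upper triangular with all minors non-negative. A minor is called an upper minor if it is non-zero for some element of $U(\varepsilon)_{\ge0}$. Let $U(\varepsilon)_{>0}$ be the set of elements of $U(\varepsilon)_{\ge0}$ all of whose upper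 minors are positive. An $(n+2)$-tuple $(a,x_n,\dots,x_1,b)\in\mathcal F_d^{(n+2)}$ is positive if there exist a basis $\varepsilon$ consistent with $(a,b)$ and $u_1,\dots,u_n\in U(\varepsilon)_{>0}$ such that $x_p=u_1\cdots u_p(b)$ for all $p=1,\dots,n$. (So $(a,x,y,b)$ is positive when $y=u_1(b)$ and $x=u_1u_2(b)$.) *)

(* Defs.v *)
From HB Require Import structures.
From mathcomp Require Import all_boot all_order all_algebra.
From mathcomp Require Import reals.

Set Implicit Arguments.
Unset Strict Implicit.
Unset Printing Implicit Defensive.

Import Order.TTheory GRing.Theory Num.Theory.

Local Open Scope ring_scope.

(* The ambient space R^d is 'cV[R]_d.  The indices 1, ..., d
   of lines and basis vectors are shifted by one to 0, ..., d - 1 ('I_d),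
   whereas the subspaces of a flag are indexed by their dimension. *)

(* Only the values f 0, ..., f d are meaningful; the dimension condition
   forces f 0 = 0 and f d = fullv. *)
Record flag (R : realType) (d : nat) : Type := Flag {
  flag_space :> nat -> {vspace 'cV[R]_d};
  flag_dim : forall i, (i <= d)%N -> \dim (flag_space i) = i;
  flag_nested : forall i j, (i <= j <= d)%N ->
    (flag_space i <= flag_space j)%VS
}.

Definition transverse (R : realType) (d n : nat) (f : n.-tuple (flag R d)) :
    Prop :=
  forall k : 'I_n -> nat, (\sum_(i < n) k i = d)%N ->
    directv (\sum_(i < n) tnth f i (k i)) /\
    (\sum_(i < n) tnth f i (k i))%VS = fullv.

(* With i0 = i + 1 the one-based index, a^i0 :&: b^(d - i0 + 1). *)
Definition L (R : realType) (d : nat) (a b : flag R d) (i : 'I_d) :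
    {vspace 'cV[R]_d} :=
  (a i.+1 :&: b (d - i)%N)%VS.

Definition consistent (R : realType) (d : nat) (a b : flag R d)
    (e : d.-tuple 'cV[R]_d) : Prop :=
  basis_of fullv e /\ forall i : 'I_d, tnth e i \in L a b i.

(* Column convention: column j holds the coordinates of u (e_j), which is the
   transpose of the row-vector convention of mxof. *)
Definition matrix_in (R : realType) (d : nat) (e : d.-tuple 'cV[R]_d)
    (u : 'End('cV[R]_d)) : 'M[R]_d :=
  \matrix_(i < d, j < d) coord e i (u (tnth e j)).

Definition increasing (k d : nat) (s : 'I_k -> 'I_d) : Prop :=
  forall i j : 'I_k, (i < j)%N -> (s i < s j)%N.

(* Used for increasing s and t, the rows and columns of the minor. *)
Definition minor (R : realType) (d : nat) (e : d.-tuple 'cV[R]_d) (k : nat)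
    (s t : 'I_k -> 'I_d) (u : 'End('cV[R]_d)) : R :=
  \det (mxsub s t (matrix_in e u)).

Definition U_nneg (R : realType) (d : nat) (e : d.-tuple 'cV[R]_d)
    (u : 'End('cV[R]_d)) : Prop :=
  [/\ forall i : 'I_d, matrix_in e u i i = 1,
      forall i j : 'I_d, (j < i)%N -> matrix_in e u i j = 0
    & forall (k : nat) (s t : 'I_k -> 'I_d), increasing s -> increasing t ->
        0 <= minor e s t u].

Definition upper_minor (R : realType) (d : nat) (e : d.-tuple 'cV[R]_d)
    (k : nat) (s t : 'I_k -> 'I_d) : Prop :=
  exists2 v : 'End('cV[R]_d), U_nneg e v & minor e s t v != 0.

Definition U_pos (R : realType) (d : nat) (e : d.-tuple 'cV[R]_d)
    (u : 'End('cV[R]_d)) : Prop :=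
  U_nneg e u /\
  forall (k : nat) (s t : 'I_k -> 'I_d), increasing s -> increasing t ->
    upper_minor e s t -> 0 < minor e s t u.

(* g = w(f) as flags; indices above d carry no information. *)
Definition flag_image (R : realType) (d : nat) (w : 'End('cV[R]_d))
    (f g : flag R d) : Prop :=
  forall i : nat, (i <= d)%N -> g i = (w @: f i)%VS.

(* The tuple x lists the middle flags in the order x_n, ..., x_1 in which they
   occur in (a, x_n, ..., x_1, b), so the flag x_(p+1) is tnth x (rev_ord p);
   it is required to be u_1 \o ... \o u_(p+1) applied to b, where u_(q+1) is
   written u q. *)
Definition positive (R : realType) (d n : nat) (a : flag R d)
    (x : n.-tuple (flag R d)) (b : flag R d) : Prop :=
  transverse [tuple of a :: rcons x b] /\
  exists (e : d.-tuple 'cV[R]_d) (u : 'I_n -> 'End('cV[R]_d)),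
    [/\ consistent a b e,
        forall p : 'I_n, U_pos e (u p)
      & forall p : 'I_n,
          flag_image (\big[@comp_lfun _ _ _ _ / \1%VF]_(q < n | (q <= p)%N) u q)
            b (tnth x (rev_ord p))].

(* Main.v *)
Require Import Defs.
From mathcomp Require Import all_boot all_order all_algebra all_fingroup.
From mathcomp Require Import reals.
From mathcomp Require Import zify ring.

Set Implicit Arguments.
Unset Strict Implicit.
Unset Printing Implicit Defensive.

Import Order.TTheory GRing.Theory Num.Theory.

Local Open Scope ring_scope.

(* Work in the basis e and let A, B be the matrices of u_1, u_2.  The line
   L_j(x, y) is spanned by A w_j with w_j in b^(d-j+1) and in B b^j (j from 1),
   so the matrix W = (w_j) is lower triangular, unipotent after rescaling, and
   for every m its first m columns span the same subspace as the last m columns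
   of B.  As the minors of B on its last m columns are positive, so are the
   minors of W on its first m columns, hence (W being triangular) its minors on
   consecutive columns are non-negative.  Cauchy-Binet makes all minors of V =
   A W on consecutive columns positive, and Fekete's argument, based on a
   three-term Pluecker relation, extends this to all minors of V.  The minor on
   the rows outside I and the columns J is the determinant of the e_i (i in I)
   together with the A w_j (j in J), up to sign.

   Transversality enters only through the minors of A and B on consecutive rows
   and the last columns: it makes them non-zero, hence positive, and the same
   Fekete argument handles arbitrary rows. *)

(** * Minors indexed by functions on the natural numbers *)

Section FunMinors.

Variable R : comNzRingType.
Implicit Types (F G : nat -> nat -> R) (s t c : nat -> nat).

(** Rows and columns are picked by functions on [nat], so that deleting, inserting or shifting an
    index is composition with [bump] or a successor, without casts between ordinal types. *)
Definition fminor F k s t : R := \det (\matrix_(i < k, j < k) F (s i) (t j)).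

Lemma eq_fminor F G k s t s' t' :
  (forall i j, (i < k)%N -> (j < k)%N -> F (s i) (t j) = G (s' i) (t' j)) ->
  fminor F k s t = fminor G k s' t'.
Proof. by move=> E; congr (\det _); apply/matrixP=> i j; rewrite !mxE E. Qed.

Lemma fminor_tr F k s t : fminor F k s t = fminor (fun i j => F j i) k t s.
Proof.
by rewrite /fminor -det_tr; congr (\det _); apply/matrixP=> i j; rewrite !mxE.
Qed.

(** Laplace expansion along row [h]. The sum depends on that row only through a linear functional
    fixed by [r] and [c], so up to sign it does not matter where the row is inserted. *)
Lemma fminor_insert F n s r c h : (h <= n)%N ->
  (forall i, (i < n)%N -> s (bump h i) = r i) ->
  fminor F n.+1 s c = (-1) ^+ h * \sum_(j < n.+1) F (s h) (c j) *
    ((-1) ^+ j * fminor F n r (fun i => c (bump j i))).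
Proof.
move=> hn sr; rewrite /fminor (expand_det_row _ (Ordinal (hn : (h < n.+1)%N))).
rewrite big_distrr; apply: eq_bigr => j _ /=; rewrite !mxE /= /cofactor exprD /=.
rewrite -mulrA [RHS]mulrCA; congr (_ * (_ * (_ * \det _))).
by apply/matrixP=> i l; rewrite !mxE /= sr.
Qed.

Lemma fminor_repeat F k s t i j : (i < j < k)%N -> s i = s j -> fminor F k s t = 0.
Proof.
case/andP=> ij jk sij.
apply: (@determinant_alternate _ _ _ (Ordinal (ltn_trans ij jk)) (Ordinal jk)).
  by rewrite -val_eqE /= ltn_eqF.
by move=> l; rewrite !mxE /= sij.
Qed.

(** Cramer's linear dependency between m+1 rows of length m: the sum expands, along its first
    column, a determinant in which column [c l] occurs twice. *)
Lemma fminor_dependency F m t c l : (l < m)%N ->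
  \sum_(i < m.+1) (-1) ^+ i * fminor F m (fun x => t (bump i x)) c * F (t i) (c l) = 0.
Proof.
move=> lm; pose c' x := if x is y.+1 then c y else c l.
transitivity (fminor F m.+1 t c'); last first.
  by rewrite fminor_tr (@fminor_repeat _ _ _ _ 0 l.+1).
rewrite /fminor (expand_det_col _ ord0); apply: eq_bigr => i _.
rewrite !mxE /cofactor /= addn0 mulrC; congr (_ * (_ * \det _)).
by apply/matrixP=> x y; rewrite !mxE.
Qed.

(* Apply to the linear dependency between the m+1 rows the functional which
   inserts a row among rows 1, ..., m-1 other than q. *)
Lemma fminor_plucker F n t c q : (0 < q < n.+2)%N ->
  fminor F n.+2 (fun i => t (bump q i)) c *
    fminor F n.+1 (fun i => t i.+1) (fun j => c j.+1) =
  fminor F n.+2 t c *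
    fminor F n.+1 (fun i => t (bump q i.+1)) (fun j => c j.+1) +
  fminor F n.+2 (fun i => t i.+1) c *
    fminor F n.+1 (fun i => t (bump q i)) (fun j => c j.+1).
Proof.
case/andP=> q0 qn.
(* [r] lists the rows [t 1], ..., [t n.+1] without [t q]; [phi] is the functional that inserts a row
   before them. *)
pose r i := t (bump q.-1 i).+1.
pose g j := (-1) ^+ j * fminor F n r (fun i => c (bump j i).+1).
pose phi x := \sum_(j < n.+1) F x (c j.+1) * g j.
have Ephi h s : (h <= n)%N -> (forall i, (i < n)%N -> s (bump h i) = r i) ->
    fminor F n.+1 s (fun j => c j.+1) = (-1) ^+ h * phi (s h).
  by move=> hn sr; rewrite (fminor_insert _ _ hn sr).
(* A row already listed in [r] would be repeated, so only rows 0, q and n+2 survive in the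
   dependency. *)
have phi0 i : (0 < i < n.+2)%N -> i != q -> phi (t i) = 0.
  move=> ib iq; pose s x := if x is y.+1 then r y else t i.
  have := Ephi 0%N s (leq0n _) (fun _ _ => erefl); rewrite expr0 mul1r => <-.
  apply: (@fminor_repeat _ _ _ _ 0 (unbump q i)); first by rewrite /unbump; lia.
  rewrite /s; have -> : unbump q i = (unbump q i).-1.+1 by rewrite /unbump; lia.
  by rewrite /r; congr t; rewrite /bump /unbump; lia.
have dep : \sum_(i < n.+3)
    (-1) ^+ i * fminor F n.+2 (fun x => t (bump i x)) c * phi (t i) = 0.
  rewrite /phi; under eq_bigr do rewrite big_distrr /=.
  rewrite exchange_big big1 //= => j _.
  under eq_bigr do rewrite mulrA.
  by rewrite -big_distrl /= (@fminor_dependency _ _ _ _ j.+1) ?mul0r// ltnS.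
have qn3 : (q < n.+3)%N by lia.
move: dep; rewrite (bigD1 ord0) //= (bigD1 ord_max) //=.
rewrite (bigD1 (Ordinal qn3)) /=; last first.
  by rewrite -!val_eqE /=; lia.
rewrite big1 ?addr0 => [|i]; last first.
  rewrite -!val_eqE /= => /andP[/andP[i0 im] iq].
  by rewrite phi0 ?mulr0//; have := ltn_ord i; lia.
rewrite (Ephi q.-1 (fun i => t i.+1)) //; last by lia.
rewrite (Ephi n (fun i => t (bump q i.+1))) //; last first.
  by move=> i lti; rewrite /r; congr t; rewrite /bump; lia.
rewrite (Ephi 0%N (fun i => t (bump q i))) //; last first.
  by move=> i lti; rewrite /r; congr t; rewrite /bump; lia.
have -> : bump q n.+1 = n.+2 by rewrite /bump; lia.
have -> : bump q 0 = 0%N by rewrite /bump; lia.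
rewrite (prednK q0) !expr0 !mul1r.
have -> : fminor F n.+2 (fun x => t (bump n.+2 x)) c = fminor F n.+2 t c.
  by apply: eq_fminor => i j lti _; congr (F (t _) _); rewrite /bump; lia.
have -> : (-1) ^+ q = - (-1) ^+ q.-1 :> R by rewrite -[in LHS](prednK q0) exprS mulN1r.
rewrite !exprS !mulN1r opprK => /eqP; rewrite addrA addr_eq0 => /eqP E.
transitivity ((-1) ^+ q.-1 * fminor F n.+2 (fun x => t (bump q x)) c * phi (t q)).
  by ring.
rewrite !mulNr opprK in E; rewrite -E; ring.
Qed.

End FunMinors.

(** * Increasing index sequences and Fekete's criterion *)

Definition incr_below (k d : nat) (s : nat -> nat) : Prop :=
  (forall i j, (i < j < k)%N -> (s i < s j)%N) /\
  (forall i, (i < k)%N -> (s i < d)%N).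

Lemma incr_belowW k d s :
  (forall i, (i.+1 < k)%N -> (s i < s i.+1)%N) ->
  (forall i, (i < k)%N -> (s i < d)%N) -> incr_below k d s.
Proof.
move=> inc bd; split=> // i j; elim: j => // j IHj; rewrite ltnS leq_eqVlt.
case/andP=> /orP[/eqP->|ij] jk; first exact: inc.
by apply: ltn_trans (inc j jk); apply: IHj; rewrite ij ltnW.
Qed.

Lemma incr_below_shift k d s : incr_below k.+1 d s -> incr_below k d (fun i => s i.+1).
Proof. by case=> inc bd; split=> [i j ijk|i ik]; [apply: inc|apply: bd]. Qed.

Lemma incr_below_le k l d s : (k <= l)%N -> incr_below l d s -> incr_below k d s.
Proof.
move=> kl [inc bd]; split=> [i j /andP[ij jk]|i ik]; [apply: inc|apply: bd]; lia.
Qed.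

Lemma incr_below_solid r k d : (r + k <= d)%N -> incr_below k d (addn r).
Proof. by move=> rkd; split; lia. Qed.

Section Positivity.

Variable R : realFieldType.
Implicit Types (F G : nat -> nat -> R) (s t : nat -> nat).

(* Induction on m, then on the spread s (m-1) - s 0.  If some q is missing
   between s 0 and s (m-1), insert it into s: the Pluecker relation expresses
   the minor at s, times a positive smaller minor, by minors of smaller size
   or spread. *)
Lemma fminor_pos_solid F k N :
  (forall m r, (m <= k)%N -> (r + m <= N)%N ->
     0 < fminor F m (addn r) (addn (k - m))) ->
  forall m s, (m <= k)%N -> incr_below m N s -> 0 < fminor F m s (addn (k - m)).
Proof.
move=> solid; elim=> [|m IHm] s mk sP.
  have := solid 0%N 0%N (leq0n _) (leq0n _).
  by congr (0 < _); apply: eq_fminor.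
have [e] := ubnP (s m - s 0%N)%N.
elim: e => // e IHe in s sP *; rewrite ltnS => se.
have [inc bd] := sP.
case: (boolP [exists i : 'I_m, s i.+1 != (s i).+1]) => [|/existsPn sS]; last first.
  have sE i : (i <= m)%N -> s i = (s 0 + i)%N.
    elim: i => [|i IHi] im; first by rewrite addn0.
    by have /negPn/eqP/= -> := sS (Ordinal im); rewrite IHi ?addnS // ltnW.
  rewrite (@eq_fminor _ F F _ s _ (addn (s 0%N)) (addn (k - m.+1))).
    apply: solid => //; have := bd m (ltnSn m); rewrite sE //; lia.
  by move=> i j; rewrite ltnS => /sE ->.
case/existsP=> -[h hm] /= gap.
have {}gap : ((s h).+1 < s h.+1)%N.
  by rewrite ltn_neqAle eq_sym gap inc // ltnSn ltnS.
case: m => // n in IHm mk sP se inc bd hm IHe *.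
(* The missing value [(s h).+1] goes in at position h+1, strictly between the end positions, so [t]
   has the same end values as [s] and [bump h.+1] recovers [s]. *)
pose t i := if (i < h.+1)%N then s i else if i == h.+1 then (s h).+1 else s i.-1.
have tP : incr_below n.+3 N t.
  apply: incr_belowW => i ik; rewrite /t.
    case: (ltngtP i.+1 h.+1) => ih.
    - by rewrite inc // ltnSn; lia.
    - have [->//|ih'] := eqVneq i h.+1.
      by case: i ih' ik ih => // i ih' ik ih /=; rewrite inc //; lia.
    - by case: ih => ->; rewrite ltnSn.
  case: (ltngtP i h.+1) => ih; [by apply: bd; lia|by apply: bd; lia|].
  by apply: leq_trans gap _; apply/ltnW/bd.
have tb i : t (bump h.+1 i) = s i.
  rewrite /t /bump; case: (leqP h.+1 i) => ih; rewrite ?add0n ?add1n /= ?ih //.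
  by rewrite ifF ?ifF //; lia.
have t0 : t 0%N = s 0%N by [].
have tl : t n.+2 = s n.+1 by rewrite -(tb n.+1) /bump; congr t; lia.
have [tinc _] := tP.
have hq : (0 < h.+1 < n.+2)%N by [].
have := fminor_plucker F t (addn (k - n.+2)) hq.
rewrite (@eq_fminor _ F F _ (fun i => t (bump h.+1 i)) _ s (addn (k - n.+2)));
  last by move=> *; rewrite tb.
have shift G u u' : (forall i, u i = u' i) ->
    fminor G n.+1 u (fun j => k - n.+2 + j.+1)%N = fminor G n.+1 u' (addn (k - n.+1)).
  by move=> E; apply: eq_fminor => i j _ _; rewrite E; congr (G _ _); lia.
rewrite (shift F _ (fun i => t i.+1)) // (shift F (fun i => t (bump h.+1 i)) s) //.
rewrite (shift F (fun i => t (bump h.+1 i.+1)) (fun i => s i.+1)) // => E.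
have P1 : 0 < fminor F n.+1 (fun i => t i.+1) (addn (k - n.+1)).
  by apply: IHm; [exact: ltnW|exact/incr_below_le/incr_below_shift/tP].
have P2 : 0 < fminor F n.+1 s (addn (k - n.+1)).
  by apply: IHm; [exact: ltnW|exact: incr_below_le sP].
have P3 : 0 < fminor F n.+1 (fun i => s i.+1) (addn (k - n.+1)).
  by apply: IHm; [exact: ltnW|exact: incr_below_shift sP].
(* Dropping the last or the first row of [t] keeps the size of the minor at [s] but reduces the
   spread. *)
have P4 : 0 < fminor F n.+2 t (addn (k - n.+2)).
  apply: IHe; first exact: incr_below_le tP.
  by have := tinc n.+1 n.+2; have := inc 0%N n.+1; rewrite t0 tl; lia.
have P5 : 0 < fminor F n.+2 (fun i => t i.+1) (addn (k - n.+2)).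
  apply: IHe; first exact: incr_below_shift tP.
  by have := tinc 0%N 1%N; have := tinc 1%N n.+2; rewrite t0 tl; lia.
by rewrite -(pmulr_lgt0 _ P1) E addr_gt0 // mulr_gt0.
Qed.

End Positivity.

(** * The Cauchy-Binet formula *)

Section CauchyBinet.

Variable R : comNzRingType.

(** Multilinearity in the rows: each row of [X *m Y] is a combination of rows of [Y]. *)
Lemma det_mulmx_sum k d (X : 'M[R]_(k, d)) (Y : 'M[R]_(d, k)) :
  \det (X *m Y) = \sum_(f : {ffun 'I_k -> 'I_d}) (\prod_i X i (f i)) * \det (rowsub f Y).
Proof.
rewrite {1}/determinant.
under eq_bigr => p _.
  under eq_bigr do rewrite mxE.
  rewrite bigA_distr_bigA /= big_distrr /=.
  over.
rewrite exchange_big /=; apply: eq_bigr => f _.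
rewrite /determinant big_distrr; apply: eq_bigr => p _ /=.
rewrite big_split /= mulrCA; congr (_ * (_ * _)).
by apply: eq_bigr => i _; rewrite mxE.
Qed.

Lemma det_rowsub_perm k d (Y : 'M[R]_(d, k)) (f : 'I_k -> 'I_d) (p : 'S_k) :
  \det (rowsub (f \o p) Y) = (-1) ^+ p * \det (rowsub f Y).
Proof.
rewrite -det_perm -det_mulmx -row_permE; congr (\det _).
by apply/matrixP=> i j; rewrite !mxE.
Qed.

Lemma det_colsub_perm k d (X : 'M[R]_(k, d)) (f : 'I_k -> 'I_d) (p : 'S_k) :
  \det (colsub (f \o p) X) = (-1) ^+ p * \det (colsub f X).
Proof.
by rewrite -[LHS]det_tr -[X in _ * X]det_tr !trmx_mxsub det_rowsub_perm.
Qed.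

(* Summing over all maps instead of the increasing ones counts every term k!
   times; the terms with f not injective vanish. *)
Lemma cauchy_binet k d (X : 'M[R]_(k, d)) (Y : 'M[R]_(d, k)) :
  \det (X *m Y) *+ k`! =
    \sum_(f : {ffun 'I_k -> 'I_d}) \det (colsub f X) * \det (rowsub f Y).
Proof.
under eq_bigr do rewrite {1}/determinant big_distrl /=.
rewrite exchange_big /= -(card_Sn k) -sumr_const.
apply: eq_bigr => p _; rewrite det_mulmx_sum.
(* Replacing f by f composed with p shows that each permutation p in the expansion of
   [\det (colsub f X)] contributes one full copy of [\det (X *m Y)]. *)
pose comp_p (f : {ffun 'I_k -> 'I_d}) := [ffun i => f (p i)].
rewrite (reindex_inj (h := comp_p)); last first.
  move=> f g /ffunP E; apply/ffunP=> i.
  by have := E (p^-1%g i); rewrite !ffunE permKV.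
apply: eq_bigr => f _ /=.
have -> : rowsub (comp_p f) Y = rowsub (f \o p) Y.
  by apply/matrixP=> i j; rewrite !mxE ffunE.
rewrite det_rowsub_perm mulrCA mulrA; congr (_ * _ * _).
by apply: eq_bigr => i _; rewrite ffunE !mxE.
Qed.

End CauchyBinet.

(** * Total positivity *)

(** Reduces the terms of Cauchy-Binet with injective index map to increasing sequences, the only
    ones for which signs of minors are known. *)
Lemma sort_injective k d (f : 'I_k -> 'I_d) : injective f ->
  exists (u : nat -> nat) (g : 'I_k -> 'I_d) (p : 'S_k),
    [/\ incr_below k d u, forall i, g i = u i :> nat & f =1 g \o p].
Proof.
move=> f_inj; pose v := [tuple f i : nat | i < k].
pose w := sort_tuple leq v.
have /tuple_permP[p vE] : perm_eq v w by rewrite perm_sym perm_sort.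
have wP (i : 'I_k) : tnth w i = f (p^-1%g i).
  have : tnth v (p^-1%g i) = tnth w i.
    by rewrite (tnth_nth 0%N) vE -tnth_nth tnth_mktuple permKV.
  by rewrite tnth_mktuple.
exists (nth 0%N w), (fun i => f (p^-1%g i)), p; split=> [|i|i].
- split=> [i j /andP[ij jk]|i ik]; last first.
    by rewrite -(tnth_nth 0%N w (Ordinal ik)) wP.
  have : (nth 0 w i <= nth 0 w j)%N.
    apply: (sorted_leq_nth leq_trans leqnn);
      rewrite ?(sort_sorted leq_total) ?inE ?size_tuple //.
    - exact: ltn_trans ij jk.
    - exact: ltnW.
  rewrite leq_eqVlt => /orP[|//].
  rewrite -(tnth_nth 0%N w (Ordinal jk)) -(tnth_nth 0%N w (Ordinal (ltn_trans ij jk))).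
  rewrite !wP => /eqP/val_inj/f_inj/perm_inj/(congr1 val)/= ijE.
  by have := ltn_eqF ij; rewrite {1}ijE eqxx.
- by rewrite -wP (tnth_nth 0%N).
- by rewrite /= permK.
Qed.

Section TotalPositivity.

Variable R : realFieldType.
Implicit Types (A B W F G : nat -> nat -> R) (s t : nat -> nat).

Definition tnn d F : Prop := forall k s t,
  incr_below k d s -> incr_below k d t -> 0 <= fminor F k s t.

Definition fmul d F G (i j : nat) : R := \sum_(l < d) F i l * G l j.

(** In Cauchy-Binet, sorting an index map changes both factors by the same sign, so no term is
    negative; the term of [u] is positive. *)
Lemma fminor_fmul_gt0 d F G k s t u :
  (forall v, incr_below k d v -> 0 <= fminor F k s v) ->
  (forall v, incr_below k d v -> 0 <= fminor G k v t) ->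
  incr_below k d u -> 0 < fminor F k s u -> 0 < fminor G k u t ->
  0 < fminor (fmul d F G) k s t.
Proof.
move=> F0 G0 uP Fu Gu.
pose X := \matrix_(i < k, l < d) F (s i) l.
pose Y := \matrix_(l < d, j < k) G l (t j).
have XE (g : 'I_k -> 'I_d) (v : nat -> nat) : (forall i, g i = v i :> nat) ->
    \det (colsub g X) = fminor F k s v.
  by move=> gv; congr (\det _); apply/matrixP=> i j; rewrite !mxE gv.
have YE (g : 'I_k -> 'I_d) (v : nat -> nat) : (forall i, g i = v i :> nat) ->
    \det (rowsub g Y) = fminor G k v t.
  by move=> gv; congr (\det _); apply/matrixP=> i j; rewrite !mxE gv.
have term_ge0 (f : {ffun 'I_k -> 'I_d}) : 0 <= \det (colsub f X) * \det (rowsub f Y).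
  case: (boolP (injectiveb f)) => [/injectiveP f_inj|/injectivePn[i [j ij fij]]].
    have [v [g [p [vP gv fg]]]] := sort_injective f_inj.
    have -> : colsub f X = colsub (g \o p) X by apply: eq_mxsub.
    have -> : rowsub f Y = rowsub (g \o p) Y by apply: eq_mxsub.
    rewrite det_colsub_perm det_rowsub_perm mulrACA -signr_addb addbb mul1r.
    by rewrite (XE _ _ gv) (YE _ _ gv) mulr_ge0 ?F0 ?G0.
  rewrite (@determinant_alternate _ _ (rowsub f Y) i j) ?mulr0 // => l.
  by rewrite !mxE fij.
have -> : fminor (fmul d F G) k s t = \det (X *m Y).
  congr (\det _); apply/matrixP=> i j; rewrite !mxE.
  by apply: eq_bigr => l _; rewrite !mxE.
rewrite -(pmulrn_lgt0 _ (fact_gt0 k)) cauchy_binet.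
have [_ ubd] := uP.
pose g := [ffun i : 'I_k => Ordinal (ubd i (ltn_ord i))].
have gu i : g i = u i :> nat by rewrite ffunE.
rewrite (bigD1 g) //= (XE _ _ gu) (YE _ _ gu) ltr_pwDl ?mulr_gt0 ?sumr_ge0 //.
Qed.

(** * Minors of the product of A with a lower unitriangular W *)

Section Core.

Variables (d : nat) (A B W : nat -> nat -> R).
Hypothesis A_tnn : tnn d A.
Hypothesis B_tnn : tnn d B.
Hypothesis A_solid : forall k r, (r + k <= d)%N ->
  fminor A k (addn r) (addn (d - k)) != 0.
Hypothesis B_solid : forall k r, (r + k <= d)%N ->
  fminor B k (addn r) (addn (d - k)) != 0.
Hypothesis W_lower : forall i j, (i < j < d)%N -> W i j = 0.
Hypothesis W_unit : forall i, (i < d)%N -> W i i = 1.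
Hypothesis W_flag : forall m, (m <= d)%N -> exists Q : 'M[R]_m,
  forall (i : nat) (j : 'I_m), (i < d)%N ->
    W i j = \sum_(l < m) B i (d - m + l)%N * Q l j.

Lemma tnn_last_gt0 F k s : tnn d F ->
  (forall k r, (r + k <= d)%N -> fminor F k (addn r) (addn (d - k)) != 0) ->
  (k <= d)%N -> incr_below k d s -> 0 < fminor F k s (addn (d - k)).
Proof.
move=> F_tnn F_solid kd sP.
apply: (@fminor_pos_solid _ F d d _ k s kd sP) => m r md rmd.
rewrite lt_def F_solid // F_tnn //; apply: incr_below_solid; lia.
Qed.

(** By [W_flag] the minors of W on its first m columns are those of B on its last m columns times
    [\det Q], a factor independent of the rows. The rows 0, ..., m-1 give the minor 1 of W, which
    forces [\det Q] to be positive. *)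
Lemma fminor_initial_gt0 m s : (m <= d)%N -> incr_below m d s ->
  0 < fminor W m s id.
Proof.
move=> md sP; have [Q WQ] := W_flag md.
have E u : incr_below m d u ->
    fminor W m u id = fminor B m u (addn (d - m)) * \det Q.
  case=> _ ubd; rewrite /fminor -det_mulmx; congr (\det _).
  apply/matrixP=> i j; rewrite !mxE WQ ?ubd //.
  by apply: eq_bigr => l _; rewrite !mxE.
have idP : incr_below m d id by split; lia.
have : fminor W m id id = 1.
  rewrite /fminor det_trig; last first.
    apply/is_trig_mxP => i j ij; rewrite mxE W_lower //.
    by have := ltn_ord j; lia.
  by apply: big1 => i _; rewrite mxE W_unit //; have := ltn_ord i; lia.
have B0 u : incr_below m d u -> 0 < fminor B m u (addn (d - m)).
  exact: tnn_last_gt0.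
rewrite !E // => Q1; rewrite mulr_gt0 ?B0 //.
by rewrite -(pmulr_rgt0 _ (B0 _ idP)) Q1.
Qed.

(** Prepend the rows 0, ..., p-1 and the columns 0, ..., p-1. The enlarged minor is block lower
    triangular with a unitriangular first block, so it equals the given one, and it lies on initial
    columns. *)
Lemma fminor_solid_gt0 k p s : (p + k <= d)%N -> incr_below k d s ->
  (forall i, (i < k)%N -> (p <= s i)%N) -> 0 < fminor W k s (addn p).
Proof.
move=> pkd [inc bd] ps.
pose u i := if (i < p)%N then i else s (i - p)%N.
have uP : incr_below (p + k) d u.
  split=> [i j /andP[ij jk]|i ik]; rewrite /u.
    case: (ltnP i p) => ip; case: (ltnP j p) => jp //; last by apply: inc; lia.
      by apply: leq_trans ip _; apply: ps; lia.
    by lia.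
  by case: (ltnP i p) => ip; [lia|apply: bd; lia].
have := fminor_initial_gt0 pkd uP.
rewrite /fminor -[X in \det X]submxK.
have -> : ursubmx (\matrix_(i < p + k, j < p + k) W (u i) j) = 0.
  apply/matrixP=> i j; rewrite !mxE /u /= ltn_ord W_lower //.
  by have := ltn_ord i; have := ltn_ord j; lia.
rewrite det_lblock det_trig; last first.
  apply/is_trig_mxP => i j ij; rewrite !mxE /u /= ltn_ord W_lower //.
  by have := ltn_ord j; lia.
rewrite big1 ?mul1r => [|i _]; last first.
  by rewrite !mxE /u /= ltn_ord W_unit //; have := ltn_ord i; lia.
congr (0 < \det _); apply/matrixP=> i j; rewrite !mxE /u /= ifF; last by lia.
by rewrite addnC addnK addnC.
Qed.

(** If [s 0] is less than p, the first row of the minor vanishes because W is lower triangular;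
    otherwise the minor is positive. *)
Lemma fminor_solid_ge0 k p s : (p + k <= d)%N -> incr_below k d s ->
  0 <= fminor W k s (addn p).
Proof.
move=> pkd sP; case: k => [|k] in pkd sP *; first by rewrite ltW // fminor_solid_gt0.
have [inc bd] := sP.
case: (leqP p (s 0%N)) => ps.
  apply/ltW/fminor_solid_gt0 => // -[//|i] ik.
  by apply: leq_trans ps _; apply/ltnW/inc.
rewrite /fminor (expand_det_row _ ord0) big1 // => j _.
by rewrite mxE W_lower ?mul0r //=; have := ltn_ord j; lia.
Qed.

Lemma fminor_fmul_all_gt0 k s t : incr_below k d s -> incr_below k d t ->
  0 < fminor (fmul d A W) k s t.
Proof.
move=> sP tP.
have kd : (k <= d)%N.
  have [inc bd] := tP; have it i : (i < k)%N -> (i <= t i)%N.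
    elim: i => // i IHi ik; have := IHi (ltnW ik); have := inc i i.+1; lia.
  by case: k it bd {sP tP inc} => // k /(_ k (ltnSn k)) + /(_ k (ltnSn k)); lia.
(* [fminor_pos_solid] frees the rows, while here the columns are to be freed: hence the transpose,
   with the row choice [s] built into [F]. *)
pose F i j := fmul d A W (s j) i.
suff : 0 < fminor F k t (addn (k - k)).
  rewrite fminor_tr; congr (0 < _); apply: eq_fminor => i j _ _.
  by rewrite /F subnn.
apply: (@fminor_pos_solid _ F k d) => // m r mk rmd.
pose s' i := s (k - m + i)%N.
have s'P : incr_below m d s'.
  have [inc bd] := sP; split=> [i j ijm|i im]; [apply: inc|apply: bd]; lia.
suff : 0 < fminor (fmul d A W) m s' (addn r) by rewrite fminor_tr.
have lastP : incr_below m d (addn (d - m)) by apply: incr_below_solid; lia.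
(* The positive term of Cauchy-Binet is the one of the last m indices: A is positive on its last
   columns, and r <= d - m puts these rows of W on or below the diagonal. *)
apply: (@fminor_fmul_gt0 d A W m s' _ (addn (d - m))) => //.
- by move=> v vP; apply: A_tnn.
- by move=> v vP; apply: fminor_solid_ge0.
- by apply: tnn_last_gt0 => //; lia.
- by apply: fminor_solid_gt0 => //; lia.
Qed.

End Core.

End TotalPositivity.

(** * Flags in coordinates *)

Lemma increasing_enum (d k : nat) (S : {set 'I_d}) : #|S| = k ->
  exists (s : nat -> nat) (g : 'I_k -> 'I_d),
    [/\ incr_below k d s, forall i, g i = s i :> nat, injective g,
      forall i, g i \in S & forall j, j \in S -> exists i, j = g i].
Proof.
move=> <-; have [s [g [p [sP gs E]]]] := sort_injective (@enum_val_inj _ (mem S)).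
have gE i : g i = enum_val (p^-1%g i) by rewrite E /= permKV.
exists s, g; split=> // [i j|i|j jS].
- by rewrite !gE => /enum_val_inj/perm_inj.
- by rewrite gE; apply: enum_valP.
- by exists (p (enum_rank_in jS j)); rewrite -[LHS](enum_rankK_in jS jS) E.
Qed.

Lemma card_ord_lt d m : (m <= d)%N -> #|[pred i : 'I_d | (i < m)%N]| = m.
Proof.
by move=> md; rewrite -sum1_card (big_ord_narrow md) big_const_ord iter_addn_0 mul1n.
Qed.

Lemma card_ord_ge d m : (m <= d)%N -> #|[pred i : 'I_d | (d - m <= i)%N]| = m.
Proof.
move=> md; have := cardC [pred i : 'I_d | (i < d - m)%N].
rewrite card_ord_lt ?leq_subr // card_ord => E.
suff -> : #|[pred i : 'I_d | (d - m <= i)%N]| = #|predC [pred i : 'I_d | (i < d - m)%N]|.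
  by apply: (@addnI (d - m)%N); rewrite E subnK.
by apply: eq_card => i; rewrite !inE leqNgt.
Qed.

Lemma sum_ord_last (R : nmodType) d k (G : nat -> R) : (k <= d)%N ->
  (forall j, (j < d - k)%N -> G j = 0) ->
  \sum_(j < d) G j = \sum_(l < k) G (d - k + l)%N.
Proof.
move=> kd G0; rewrite -(big_mkord xpredT) (big_cat_nat (n := d - k)) ?leq_subr //=.
rewrite big_nat big1 ?add0r; last by move=> j /andP[_ /G0].
rewrite -{1}[(d - k)%N]add0n big_addn subKn // big_mkord.
by apply: eq_bigr => i _; rewrite addnC.
Qed.

Section Coordinates.

Variables (K : fieldType) (V : vectType K) (d : nat) (e : d.-tuple V).
Hypothesis e_basis : basis_of fullv e.

Lemma coord_decomp z : z = \sum_i coord e i z *: tnth e i.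
Proof.
rewrite {1}(coord_basis e_basis (memvf z)).
by apply: eq_bigr => i _; rewrite (tnth_nth 0).
Qed.

Lemma coord_tnth i j : coord e i (tnth e j) = (i == j)%:R.
Proof. by rewrite (tnth_nth 0) coord_free ?(basis_free e_basis) // eq_sym. Qed.

(** The selected basis vectors span a subspace of [U]. The others contribute at most their number to
    the dimension of the whole space, so this subspace has dimension at least [#|P|] and equals
    [U]. *)
Lemma mem_span_coord (U : {vspace V}) (P : pred 'I_d) :
  (forall i, P i -> tnth e i \in U) -> #|P| = \dim U ->
  forall z, (z \in U) <-> (forall i, ~~ P i -> coord e i z = 0).
Proof.
move=> eU cP.
have coordU z : (forall i, ~~ P i -> coord e i z = 0) ->
    z \in (\sum_(i | P i) <[tnth e i]>)%VS.
  move=> z0; rewrite [z]coord_decomp (bigID P) /= [X in _ + X]big1 ?addr0.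
    by apply: memv_sumr => i _; rewrite memvZ // memv_line.
  by move=> i Pi; rewrite z0 // scale0r.
have sU : (\sum_(i | P i) <[tnth e i]> <= U)%VS.
  by apply/subv_sumP => i Pi; rewrite -memvE eU.
have dimS (Q : pred 'I_d) : (\dim (\sum_(i | Q i) <[tnth e i]>) <= #|Q|)%N.
  apply: leq_trans (dimv_leq_sum _ _ _) _; rewrite -sum1_card.
  by apply: leq_sum => i _; rewrite dim_vline leq_b1.
have full : (\sum_(i | P i) <[tnth e i]> + \sum_(i | ~~ P i) <[tnth e i]>)%VS = fullv.
  apply/vspaceP => z; rewrite memvf [z]coord_decomp (bigID P) /=.
  by apply: memv_add; apply: memv_sumr => i _; rewrite memvZ // memv_line.
have UE : (\sum_(i | P i) <[tnth e i]>)%VS = U.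
  apply/eqP; rewrite eqEdim sU -cP /=.
  have dimf := size_basis e_basis.
  have [] := dimv_add_leqif (\sum_(i | P i) <[tnth e i]>) (\sum_(i | ~~ P i) <[tnth e i]>).
  rewrite full dimf => h _; rewrite -(leq_add2r #|predC P|) cardC card_ord.
  by apply: leq_trans h _; rewrite leq_add2l dimS.
move=> z; split=> [|/coordU]; last by move/(subvP sU).
rewrite -UE => /memv_sumP[v vP ->] i Pi; rewrite linear_sum big1 // => j Pj.
have /vlineP[c ->] := vP j Pj.
rewrite linearZ /= coord_tnth; case: eqP => [ij|_]; last by rewrite mulr0.
by rewrite ij Pj in Pi.
Qed.

End Coordinates.

(** * Matrices of endomorphisms in a basis *)

Section Endomorphisms.

Variables (R : realType) (n : nat).
Local Notation d := n.+1.
Variable e : d.-tuple 'cV[R]_d.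
Hypothesis e_basis : basis_of fullv e.

(* A junk value when i or j is at least d, since inord then returns 0. *)
Definition entry (u : 'End('cV[R]_d)) (i j : nat) : R :=
  matrix_in e u (inord i) (inord j).

Lemma coord_lfun (u : 'End('cV[R]_d)) i z :
  coord e i (u z) = \sum_j matrix_in e u i j * coord e j z.
Proof.
rewrite {1}(coord_decomp e_basis z) !linear_sum; apply: eq_bigr => j _.
by rewrite !linearZ /= mxE mulrC.
Qed.

Lemma coord_lfun_last (u : 'End('cV[R]_d)) i z m : (m <= d)%N ->
  (forall j : 'I_d, (j < d - m)%N -> coord e j z = 0) ->
  coord e i (u z) =
    \sum_(l < m) entry u i (d - m + l) * coord e (inord (d - m + l)) z.
Proof.
move=> md z0; rewrite coord_lfun.
rewrite -(@sum_ord_last _ d m (fun j => entry u i j * coord e (inord j) z)) //.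
  by apply: eq_bigr => j _; rewrite /entry !inord_val.
by move=> j jm; rewrite z0 ?mulr0 ?inordK //; lia.
Qed.

Lemma U_nneg_tnn u : U_nneg e u -> tnn d (entry u).
Proof.
case=> _ _ u_nneg k s t [sinc sbd] [tinc tbd].
have -> : fminor (entry u) k s t = minor e (fun i : 'I_k => inord (s i))
    (fun i : 'I_k => inord (t i)) u.
  by congr (\det _); apply/matrixP=> i j; rewrite !mxE.
by apply: u_nneg => i j ij; rewrite !inordK ?sbd ?tbd // ?sinc ?tinc ?ij /=.
Qed.

(** The last k coordinates of the vectors z, one for each q in the window of rows, form the columns
    of a right inverse of the block. *)
Lemma entry_solid_neq0 (u : 'End('cV[R]_d)) k r : (r + k <= d)%N ->
  (forall q : 'I_d, (r <= q < r + k)%N -> exists z,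
     (forall j : 'I_d, (j < d - k)%N -> coord e j z = 0) /\
     (forall i : 'I_d, (r <= i < r + k)%N ->
        coord e i (u z) = coord e i (tnth e q))) ->
  fminor (entry u) k (addn r) (addn (d - k)) != 0.
Proof.
move=> rkd hz.
have {}hz (q : 'I_k) : exists z,
     (forall j : 'I_d, (j < d - k)%N -> coord e j z = 0) /\
     (forall i : 'I_d, (r <= i < r + k)%N ->
        coord e i (u z) = coord e i (tnth e (inord (r + q)))).
  by apply: hz; rewrite inordK; have := ltn_ord q; lia.
have [z zP] := fin_all_exists hz.
pose N : 'M[R]_k := \matrix_(l, q) coord e (inord (d - k + l)) (z q).
rewrite -unitfE -unitmxE.
suff /mulmx1_unit[] : \matrix_(i < k, j < k) entry u (r + i) (d - k + j) *m N = 1%:M.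
  by [].
apply/matrixP=> i q; rewrite !mxE; have [z0 zq] := zP q.
have ik := ltn_ord i; have qk := ltn_ord q.
transitivity (coord e (inord (r + i)) (u (z q))).
  rewrite (@coord_lfun_last _ _ _ k) //; last by lia.
  by apply: eq_bigr => l _; rewrite !mxE inordK //; lia.
rewrite zq ?inordK ?(coord_tnth e_basis); try lia.
by rewrite -!val_eqE /= !inordK ?eqn_add2l //; lia.
Qed.

End Endomorphisms.

(** * Positive quadruples of flags *)

Lemma transverse4_full (R : realType) (d : nat) (a x y b : flag R d) :
  transverse [tuple of a :: rcons [tuple x; y] b] ->
  forall k0 k1 k2 k3, (k0 + k1 + k2 + k3)%N = d ->
  (a k0 + x k1 + y k2 + b k3)%VS = fullv.
Proof.
move=> tr k0 k1 k2 k3 kd.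
have [|_] := tr (fun i => nth 0%N [:: k0; k1; k2; k3] i).
  by rewrite !big_ord_recl big_ord0 /= addn0 !addnA.
by rewrite !big_ord_recl big_ord0 !(tnth_nth a) /= addv0 !addvA.
Qed.

Lemma positive_images (R : realType) (d : nat) (x y b : flag R d)
    (u : 'I_2 -> 'End('cV[R]_d)) :
  (forall p : 'I_2,
     flag_image (\big[@comp_lfun _ _ _ _ / \1%VF]_(q < 2 | (q <= p)%N) u q)
       b (tnth [tuple x; y] (rev_ord p))) ->
  (forall m, (m <= d)%N -> y m = (u ord0 @: b m)%VS) /\
  (forall m, (m <= d)%N -> x m = (u ord0 @: (u ord_max @: b m))%VS).
Proof.
have E : index_enum 'I_2 = [:: ord0; ord_max].
  by apply: (inj_map val_inj); rewrite /index_enum -enumT val_enum_ord.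
move=> im; split=> m md.
  by have := im ord0 m md; rewrite E !big_cons big_nil /= comp_lfun1r.
by have := im ord_max m md; rewrite E !big_cons big_nil /= comp_lfun1r limg_comp.
Qed.

Section PositiveQuadruple.

Variables (R : realType) (n : nat).
Local Notation d := n.+1.
Local Notation V := 'cV[R]_d.
Variables (a x y b : flag R d) (e : d.-tuple V) (u1 u2 : 'End(V)).
Hypothesis transv : forall k0 k1 k2 k3, (k0 + k1 + k2 + k3)%N = d ->
  (a k0 + x k1 + y k2 + b k3)%VS = fullv.
Hypothesis e_ab : consistent a b e.
Hypothesis u1_nneg : U_nneg e u1.
Hypothesis u2_nneg : U_nneg e u2.
Hypothesis yE : forall m, (m <= d)%N -> y m = (u1 @: b m)%VS.
Hypothesis xE : forall m, (m <= d)%N -> x m = (u1 @: (u2 @: b m))%VS.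

Let e_basis : basis_of fullv e := proj1 e_ab.

Lemma flag0 (f : flag R d) : f 0%N = 0%VS.
Proof. by apply/eqP; rewrite -dimv_eq0 flag_dim. Qed.

Lemma flag_full (f : flag R d) : f d = fullv.
Proof.
by apply/eqP; rewrite eqEdim subvf (size_basis e_basis) flag_dim /=.
Qed.

Lemma mem_flag_a m z : (m <= d)%N ->
  (z \in a m) <-> (forall i : 'I_d, (m <= i)%N -> coord e i z = 0).
Proof.
move=> md; have ea (i : 'I_d) : (i < m)%N -> tnth e i \in a m.
  move=> im; have := (proj2 e_ab) i; rewrite memv_cap => /andP[+ _].
  by apply/subvP/flag_nested; rewrite im md.
have := mem_span_coord e_basis ea _ z; rewrite card_ord_lt // flag_dim // => /(_ erefl).
by move=> ->; split=> h i; have := h i; rewrite -leqNgt.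
Qed.

Lemma mem_flag_b m z : (m <= d)%N ->
  (z \in b m) <-> (forall i : 'I_d, (i < d - m)%N -> coord e i z = 0).
Proof.
move=> md; have eb (i : 'I_d) : (d - m <= i)%N -> tnth e i \in b m.
  move=> im; have := (proj2 e_ab) i; rewrite memv_cap => /andP[_].
  by apply/subvP/flag_nested; rewrite md andbT; lia.
have := mem_span_coord e_basis eb _ z; rewrite card_ord_ge // flag_dim // => /(_ erefl).
by move=> ->; split=> h i; have := h i; rewrite -ltnNge.
Qed.

(** The image of the whole space [b d] is [y d], which has dimension d. *)
Lemma lker_u1 : lker u1 == 0%VS.
Proof.
have := limg_ker_dim u1 (b d); rewrite -yE // !flag_dim // flag_full capfv.
by rewrite -dimv_eq0; lia.
Qed.

Lemma u1_inj : injective u1.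
Proof. exact/lker0P/lker_u1. Qed.

Lemma limg_flag_a m : (m <= d)%N -> (u1 @: a m)%VS = a m.
Proof.
move=> md; apply/eqP; rewrite eqEdim limg_dim_eq ?leqnn ?andbT; last first.
  by rewrite (eqP lker_u1) capv0.
apply/subvP => _ /memv_imgP[z /(mem_flag_a _ md) z0 ->]; apply/(mem_flag_a _ md) => i mi.
have [_ u1_upper _] := u1_nneg.
rewrite (coord_lfun e_basis) big1 // => j _.
case: (leqP m j) => mj; first by rewrite z0 // mulr0.
by rewrite u1_upper ?mul0r //; apply: leq_trans mj mi.
Qed.

(** Decompose [e_q] along a^r + y^k + b^(d-r-k). On the coordinates r, ..., r+k-1 the parts in a and
    b vanish, so there [e_q] agrees with the part in y, which is [u1 z] with z in b^k. *)
Lemma u1_solid k r : (r + k <= d)%N ->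
  fminor (entry e u1) k (addn r) (addn (d - k)) != 0.
Proof.
move=> rkd; apply: (entry_solid_neq0 e_basis rkd) => q _.
have := memvf (tnth e q); rewrite -(@transv r 0 k (d - r - k)); last by lia.
rewrite flag0 addv0 yE; last by lia.
case/memv_addP=> _ /memv_addP[al ala [_ /memv_imgP[z zb ->] ->]] [be beb ->].
exists z; split; first by apply/mem_flag_b => //; lia.
move=> i /andP[ri irk]; rewrite !linearD /=.
have rd : (r <= d)%N by lia.
have sd : (d - r - k <= d)%N by lia.
by rewrite ((mem_flag_a al rd).1 ala) // ((mem_flag_b be sd).1 beb) ?addr0 ?add0r //; lia.
Qed.

(** Since u1 preserves the flag a, the sum a^r + x^k + y^(d-r-k) is the image under u1 of a^r +
    u2(b^k) + b^(d-r-k). Decomposing [u1 e_q] and cancelling u1 leads back to the argument for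
    u1. *)
Lemma u2_solid k r : (r + k <= d)%N ->
  fminor (entry e u2) k (addn r) (addn (d - k)) != 0.
Proof.
move=> rkd; apply: (entry_solid_neq0 e_basis rkd) => q _.
have := memvf (u1 (tnth e q)); rewrite -(@transv r k (d - r - k) 0); last by lia.
have rd : (r <= d)%N by lia.
have kd : (k <= d)%N by lia.
have sd : (d - r - k <= d)%N by lia.
rewrite flag0 addv0 (xE kd) (yE sd) -{1}(limg_flag_a rd).
rewrite -!limgD => /memv_imgP[_ /memv_addP[
  _ /memv_addP[al ala [_ /memv_imgP[z zb ->] ->]] [be beb ->]]].
move/u1_inj => ->; exists z; split; first by apply/mem_flag_b => //; lia.
move=> i /andP[ri irk]; rewrite !linearD /=.
by rewrite ((mem_flag_a al rd).1 ala) // ((mem_flag_b be sd).1 beb) ?addr0 ?add0r //; lia.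
Qed.

Lemma cap_xy j : (j < d)%N -> (x j.+1 :&: y (d - j.+1)%N)%VS = 0%VS.
Proof.
move=> jd; apply/eqP; rewrite -dimv_eq0.
have := dimv_sum_cap (x j.+1) (y (d - j.+1)%N).
have := @transv 0 j.+1 (d - j.+1) 0; rewrite !flag0 add0v addv0 => -> //; last by lia.
rewrite (size_basis e_basis) !flag_dim ?leq_subr //; lia.
Qed.

(** A non-zero v in [L x y j] is [u1 w] with w in b^(d-j), which kills the coordinates of w before
    j. Coordinate j is non-zero, as otherwise v would lie in the zero intersection of [cap_xy]; so w
    can be normalised. *)
Lemma line_vector (j : 'I_d) : exists w z,
  [/\ u1 w \in L x y j, coord e j w = 1,
      forall i : 'I_d, (i < j)%N -> coord e i w = 0,
      z \in b j.+1 & w = u2 z].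
Proof.
have jd := ltn_ord j.
have Lneq0 : L x y j != 0%VS.
  rewrite -dimv_eq0 /L.
  have := dimv_sum_cap (x j.+1) (y (d - j)%N).
  rewrite !flag_dim ?leq_subr //.
  have := dimvS (subvf (x j.+1 + y (d - j)%N)%VS); rewrite (size_basis e_basis).
  by lia.
set v := vpick (L x y j).
have v0 : v != 0 by rewrite vpick0.
have := memv_pick (L x y j); rewrite -/v memv_cap => /andP[vx vy].
have := vx; rewrite xE // => /memv_imgP[_ /memv_imgP[z zb ->] vE].
have := vy; rewrite yE ?leq_subr // => /memv_imgP[w wb vE'].
have wz : w = u2 z by apply: u1_inj; rewrite -vE -vE'.
have w0 (i : 'I_d) : (i < j)%N -> coord e i w = 0.
  by move=> ij; apply: (mem_flag_b w (leq_subr j d)).1 => //; rewrite subKn // ltnW.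
have wj : coord e j w != 0.
  apply: contra v0 => /eqP wj; rewrite -memv0 -(cap_xy jd) memv_cap vx /=.
  rewrite yE ?leq_subr // vE'; apply/memv_img/mem_flag_b; first exact: leq_subr.
  move=> i; rewrite subKn // ltnS leq_eqVlt => /orP[/eqP/val_inj->//|]; exact: w0.
exists ((coord e j w)^-1 *: w), ((coord e j w)^-1 *: z); split.
- by rewrite linearZ /= -vE' memvZ // memv_pick.
- by rewrite linearZ /= mulVf.
- by move=> i ij; rewrite linearZ /= (w0 i ij) mulr0.
- exact: memvZ.
- by rewrite linearZ /= -wz.
Qed.

Lemma line_vectors_minors : exists v : 'I_d -> V,
  (forall j, v j \in L x y j) /\
  forall k s t, incr_below k d s -> incr_below k d t ->
    0 < fminor (fun i j => coord e (inord i) (v (inord j))) k s t.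
Proof.
have [w hw] := fin_all_exists line_vector; have [z wP] := fin_all_exists hw.
exists (fun j => u1 (w j)); split=> [j|k s t sP tP]; first by case: (wP j).
pose W i j : R := coord e (inord i) (w (inord j)).
have -> : fminor (fun i j => coord e (inord i) (u1 (w (inord j)))) k s t =
    fminor (fmul d (entry e u1) W) k s t.
  apply: eq_fminor => i j _ _; rewrite (coord_lfun e_basis).
  by apply: eq_bigr => l _; rewrite /entry /W !inord_val.
apply: (@fminor_fmul_all_gt0 _ d _ (entry e u2) W) => //.
- exact: U_nneg_tnn.
- exact: U_nneg_tnn.
- exact: u1_solid.
- exact: u2_solid.
- move=> i j /andP[ij jd]; case: (wP (inord j)) => _ _ + _ _; apply.
  by rewrite !inordK //; apply: ltn_trans jd.
- by move=> i id; case: (wP (inord i)).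
- move=> m md.
  (* For j < m the vector [z j] lies in b^m, so column j of W combines the last m columns of the
     matrix of u2, with the last m coordinates of [z j] as coefficients. *)
  exists (\matrix_(l, j) coord e (inord (d - m + l)) (z (inord j))) => i j id.
  rewrite /W; case: (wP (inord j)) => _ _ _ zb ->.
  have jm := ltn_ord j.
  have /(mem_flag_b _ md) z0 : z (inord j) \in b m.
    apply: (subvP _ _ zb); apply: flag_nested; rewrite md andbT inordK //.
    exact: leq_trans jm md.
  rewrite (coord_lfun_last e_basis _ _ md z0).
  by apply: eq_bigr => l _; rewrite !mxE /entry inordK.
Qed.

Lemma lines_span (I J : {set 'I_d}) : (#|I| + #|J|)%N = d ->
  (\sum_(i in I) L a b i + \sum_(j in J) L x y j)%VS = fullv.
Proof.
move=> IJ; have [v [vL v_pos]] := line_vectors_minors.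
have cI : #|~: I| = #|J| by have := cardsC I; rewrite card_ord; lia.
have [s [g [sP gs g_inj _ gI]]] := increasing_enum cI.
have [t [h [tP ht _ hJ _]]] := increasing_enum (erefl #|J|).
pose X := \matrix_(i < #|J|, j < #|J|) coord e (g i) (v (h j)).
have Xu : X \in unitmx.
  rewrite unitmxE unitfE; apply: lt0r_neq0.
  have := v_pos _ _ _ sP tP; congr (0 < \det _); apply/matrixP => i j.
  by rewrite !mxE -gs -ht !inord_val.
set S := (_ + _)%VS.
have eS i : i \in I -> tnth e i \in S.
  move=> iI; apply: (subvP (addvSl _ _)); apply: (subvP (sumv_sup i iI (subvv _))).
  exact: (proj2 e_ab).
have vS j : j \in J -> v j \in S.
  by move=> jJ; apply: (subvP (addvSr _ _)); apply: (subvP (sumv_sup j jJ (subvv _))).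
have coordS r : (forall i, i \notin I -> coord e i r = 0) -> r \in S.
  move=> r0; rewrite [r](coord_decomp e_basis) memv_suml // => i _.
  case: (boolP (i \in I)) => [/eS|/r0->]; first exact: memvZ.
  by rewrite scale0r mem0v.
apply/vspaceP => z; rewrite memvf [z](coord_decomp e_basis) memv_suml // => i _.
apply: memvZ; case: (boolP (i \in I)) => [/eS//|iI].
have [|q ->] := gI i; first by rewrite inE.
(* Column q of the inverse of X makes c agree with [e_(g q)] in all coordinates outside I, so their
   difference lies in the span of the [e_i] with i in I. *)
pose c := \sum_l invmx X l q *: v (h l).
have cS : c \in S by apply: memv_suml => l _; rewrite memvZ // vS.
rewrite -[tnth _ _](subKr c) memvB //; apply: coordS => j jI.
have [|p ->] := gI j; first by rewrite inE.
have Xpq : \sum_l invmx X l q * coord e (g p) (v (h l)) = (p == q)%:R.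
  transitivity ((X *m invmx X) p q); last by rewrite mulmxV // mxE.
  by rewrite mxE; apply: eq_bigr => l _; rewrite [X p l]mxE mulrC.
rewrite linearB /= (coord_tnth e_basis) linear_sum (inj_eq g_inj) -Xpq.
by apply/eqP; rewrite subr_eq0; apply/eqP/eq_bigr => l _; rewrite linearZ.
Qed.

End PositiveQuadruple.

Theorem theorem3p6 (R : realType) (d : nat) (hd : (2 <= d)%N)
    (a x y b : flag R d) (hpos : positive a [tuple x; y] b)
    (I J : {set 'I_d}) (hIJ : (#|I| + #|J|)%N = d) :
  (\sum_(i in I) L a b i + \sum_(j in J) L x y j)%VS = fullv.
Proof.
(* The coordinate lemmas use [inord], which needs the dimension to be a successor. *)
case: d hd => // n _ in a x y b hpos I J hIJ *.
have [/transverse4_full transv [e [u [e_ab u_pos u_im]]]] := hpos.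
have [yE xE] := positive_images u_im.
have [u1_nneg _] := u_pos ord0; have [u2_nneg _] := u_pos ord_max.
exact: (lines_span transv e_ab u1_nneg u2_nneg yE xE).
Qed.
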